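(* For every fixed integer $k\ge 1$ there exists a constant $c_k>0$, depending only on $k$, such that for every non-empty finite set $D\subset\mathbb{R}$ with $|D|=m$, $$|\Sigma(D)|\ \ge\ c_k\,\frac{m^{2k+1}}{E_k(D)}.$$
   Context: For a finite set $D\subset\mathbb{R}$, the subset-sum set is $\Sigma(D)=\bigl\{\sum_{x\in S}x:\ S\subseteq D\bigr\}$ (the empty sum being $0$). For an integer $k\ge1$, the $k$-th additive energy is $$E_k(D)=\#\bigl\{(a_1,\dots,a_k,b_1,\dots,b_k)\in D^{2k}:\ a_1+\cdots+a_k=b_1+\cdots+b_k\bigr\}.$$ *)

(* Defs.v *)
From mathcomp Require Import all_boot all_order all_algebra finmap.
From mathcomp Require Import reals.

Set Implicit Arguments.
Unset Strict Implicit.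
Unset Printing Implicit Defensive.

Import GRing.Theory Num.Theory.

Local Open Scope fset_scope.
Local Open Scope ring_scope.

Definition subset_sums (R : realType) (D : {fset R}) : {fset R} :=
  [fset \sum_(x <- S) x | S : {fset R} in fpowerset D].

Definition additive_energy (R : realType) (k : nat) (D : {fset R}) : nat :=
  #|[set ab : {ffun 'I_k -> D} * {ffun 'I_k -> D} |
      \sum_(i < k) val (ab.1 i) == \sum_(i < k) val (ab.2 i)]|.

(* Main.v *)
(* At least half of the nonzero elements of D have the same sign; take 2kq of
   them, with q of order m / k, sorted by absolute value: u_0 < u_1 < ...
   Picking one element in each of k blocks of length q in the lower half gives
   q^k low sums, and the high sums add the first jk elements of the upper half,
   j < q. Consecutive high sums differ by more than any low sum, so a collision
   between (low + high) sums forces equal j and equal low sums: there are at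
   most q E_k(D) collisions among the q^(k+1) pairs, and Cauchy-Schwarz gives
   q^(2k+2) <= |Sigma(D)| q E_k(D). *)

Require Import Defs.
From mathcomp Require Import all_boot all_order all_algebra finmap.
From mathcomp Require Import reals zify.

Set Implicit Arguments.
Unset Strict Implicit.
Unset Printing Implicit Defensive.

Import Order.TTheory GRing.Theory Num.Theory.

Local Open Scope fset_scope.
Local Open Scope ring_scope.

(** * Counting collisions by Cauchy-Schwarz *)

Lemma sqr_sum_le_card (B : finType) (n : B -> nat) :
  ((\sum_b n b) ^ 2 <= #|B| * \sum_b n b ^ 2)%N.
Proof.
(* Doubling turns the bound into a sum of [2ab <= a^2 + b^2] over all pairs of indices. *)
rewrite -(leq_pmul2l (isT : 0 < 2)%N) -mulnn big_distrlr /= big_distrr /=.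
have -> : (2 * (#|B| * \sum_b n b ^ 2) =
    \sum_b \sum_b' (n b ^ 2 + n b' ^ 2))%N.
  under [RHS]eq_bigr => b _ do rewrite big_split /= sum_nat_const.
  by rewrite big_split /= sum_nat_const -big_distrr /= addnn mul2n.
apply: leq_sum => b _; rewrite big_distrr /=.
by apply: leq_sum => b' _; apply: nat_Cauchy.
Qed.

(** The fibres of [g] partition [A], and the colliding pairs number the sum of the squared fibre
    sizes. *)
Lemma card_sqr_le_collisions (A B : finType) (g : A -> B) :
  (#|A| ^ 2 <= #|B| * #|[set p : A * A | g p.1 == g p.2]|)%N.
Proof.
have cA : (#|A| = \sum_b #|[set a | g a == b]|)%N.
  rewrite -sum1_card (partition_big g xpredT) //=.
  by apply: eq_bigr => b _; rewrite -sum1dep_card.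
have cP : (#|[set p : A * A | g p.1 == g p.2]| =
    \sum_b #|[set a | g a == b]| ^ 2)%N.
  rewrite -sum1dep_card (partition_big (fun p : A * A => g p.1) xpredT) //=.
  apply: eq_bigr => b _.
  rewrite -mulnn -cardsX -sum1_card; apply: eq_bigl => -[a a'] /=.
  by rewrite !inE /= andbC; case: eqP => //= ->; rewrite eq_sym.
by rewrite cP {1}cA; apply: sqr_sum_le_card.
Qed.

Lemma sum_in_subset_sums (R : realType) (D : {fset R}) (r : seq R) :
  uniq r -> {subset r <= D} -> \sum_(x <- r) x \in subset_sums D.
Proof.
move=> ur sub; apply/imfsetP; exists (seq_fset tt r).
  change (seq_fset tt r \in fpowerset D).
  by rewrite fpowersetE; apply/fsubsetP => x; rewrite seq_fsetE => /sub.
by apply: perm_big; rewrite perm_sym -{2}(undup_id ur) seq_fset_perm.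
Qed.

(** * Low and high sums along an increasing positive sequence *)

Section Blocks.

(** In the application [e] is the majority sign and [u] lists absolute values in increasing order,
    so that [e * u n] recovers an element of [D]. *)
Variables (R : realType) (k q : nat) (e : R) (D : {fset R}) (u : nat -> R).
Hypothesis k_gt0 : (0 < k)%N.
Hypothesis e_neq0 : e != 0.
Hypothesis u_gt0 : forall n, (n < 2 * (k * q))%N -> 0 < u n.
Hypothesis u_lt :
  forall m n, (m < n)%N -> (n < 2 * (k * q))%N -> u m < u n.
Hypothesis u_in : forall n, (n < 2 * (k * q))%N -> e * u n \in D.

Let T := {ffun 'I_k -> 'I_q}.

Definition block_index (f : T) (i : 'I_k) : nat := (i * q + f i)%N.

Definition low_sum (f : T) : R := \sum_i u (block_index f i).
Definition high_sum (j : nat) : R :=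
  \sum_(n <- iota (k * q) (j * k)) u n.

Lemma block_index_lt f i : (block_index f i < k * q)%N.
Proof.
rewrite /block_index; have := ltn_ord (f i); have := ltn_ord i.
by move: (nat_of_ord i) (nat_of_ord (f i)) => a b; nia.
Qed.

(** Division by [q] recovers [i] as quotient and [f i] as remainder. *)
Lemma block_index_inj2 f f' i i' :
  block_index f i = block_index f' i' -> i = i' /\ f i = f' i'.
Proof.
rewrite /block_index => E.
have q_gt0 : (0 < q)%N by apply: leq_ltn_trans (ltn_ord (f i)).
split; apply: val_inj => /=.
  have := congr1 (divn^~ q) E.
  by rewrite /= !divnMDl // !divn_small // !addn0.
by have := congr1 (modn^~ q) E; rewrite /= !modnMDl !modn_small.
Qed.

Lemma u_inj : {in [pred n | (n < 2 * (k * q))%N] &, injective u}.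
Proof.
move=> m n; rewrite !inE => hm hn E.
case: (ltngtP m n) => // [/u_lt /(_ hn)|/u_lt /(_ hm)]; by rewrite E ltxx.
Qed.

(** Low indices lie in distinct blocks below [k * q], high ones start at [k * q] and, as [j < q],
    stay below [2 * (k * q)]; no element is used twice. *)
Lemma low_high_in_subset_sums f (j : 'I_q) :
  e * (low_sum f + high_sum j) \in subset_sums D.
Proof.
pose r := [seq block_index f i | i <- enum 'I_k] ++ iota (k * q) (j * k).
have rlt n : n \in r -> (n < 2 * (k * q))%N.
  rewrite mem_cat => /orP[/mapP[i _ ->]|].
    by have := block_index_lt f i; lia.
  by rewrite mem_iota; have := ltn_ord j; nia.
have ur : uniq r.
  rewrite cat_uniq iota_uniq map_inj_uniq ?enum_uniq ?andbT //=; last first.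
    by move=> i i' /block_index_inj2[].
  apply/hasPn => n; rewrite mem_iota => hn; apply/mapP => -[i _ E].
  by have := block_index_lt f i; rewrite -E; lia.
have -> : e * (low_sum f + high_sum j) = \sum_(x <- [seq e * u n | n <- r]) x.
  by rewrite big_map -big_distrr /= big_cat big_map big_enum.
apply: sum_in_subset_sums.
  rewrite map_inj_in_uniq // => m n /rlt hm /rlt hn /(mulfI e_neq0).
  exact: u_inj.
by move=> x /mapP[n /rlt hn ->]; apply: u_in.
Qed.

(* Moving from [j] to [j'] adds at least [k] high terms, each larger than any
   of the [k] terms of a low sum. *)
Lemma high_sum_jump f f' (j j' : nat) : (j < j')%N -> (j' < q)%N ->
  low_sum f + high_sum j < low_sum f' + high_sum j'.
Proof.
move=> jj' j'q.
have klt n : (n < k * q)%N -> (n < 2 * (k * q))%N by lia.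
have kq : (k * q < 2 * (k * q))%N by nia.
have low0 : 0 < low_sum f'.
  rewrite /low_sum (bigD1 (Ordinal k_gt0)) //=.
  apply: ltr_wpDr; last exact/u_gt0/klt/block_index_lt.
  by apply: sumr_ge0 => i _; apply/ltW/u_gt0/klt/block_index_lt.
have lowlt : low_sum f < u (k * q)%N *+ k.
  rewrite -[k in _ *+ k]card_ord -sumr_const.
  apply: ltr_sum => [|i _].
    by apply/hasP; exists (Ordinal k_gt0) => //; apply: mem_index_enum.
  by apply: u_lt (block_index_lt f i) kq.
have highle : high_sum j + u (k * q)%N *+ k <= high_sum j'.
  (* The [j' * k] terms split into the first [j * k], the next [k], which give the gain, and a
     nonnegative rest. *)
  rewrite /high_sum; have -> : (j' * k = j * k + k + (j' - j.+1) * k)%N by nia.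
  rewrite !iotaD !big_cat /= -addrA lerD2l.
  rewrite -[X in X <= _]addr0; apply: lerD; last first.
    rewrite big_seq; apply: sumr_ge0 => n; rewrite mem_iota => hn.
    by apply/ltW/u_gt0; nia.
  have -> : u (k * q)%N *+ k = \sum_(n <- iota (k * q + j * k) k) u (k * q)%N.
    by rewrite big_const_seq count_predT size_iota iter_addr_0.
  rewrite big_seq [X in _ <= X]big_seq; apply: ler_sum => n.
  rewrite mem_iota => hn.
  (* Equality occurs when [j = 0], where the added terms begin at [k * q] itself. *)
  have [->//|nk] := eqVneq n (k * q)%N.
  by apply/ltW/u_lt; nia.
apply: (@lt_le_trans _ _ (high_sum j')).
  by apply: lt_le_trans highle; rewrite addrC ltrD2l.
by rewrite lerDr ltW.
Qed.

Lemma low_high_inj f f' (j j' : 'I_q) :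
  low_sum f + high_sum j = low_sum f' + high_sum j' ->
  j = j' /\ low_sum f = low_sum f'.
Proof.
move=> E; have jj' : j = j'.
  apply: val_inj => /=; case: (ltngtP j j') => // lt.
  - by have := high_sum_jump f f' lt (ltn_ord _); rewrite E ltxx.
  - by have := high_sum_jump f' f lt (ltn_ord _); rewrite E ltxx.
by split=> //; move: E; rewrite jj' => /addIr.
Qed.

(** Reads a low sum as a [k]-tuple of [D], so that the additive energy counts coincidences of low
    sums. *)
Definition low_tuple (f : T) : {ffun 'I_k -> D} :=
  [ffun i => [` u_in (leq_trans (block_index_lt f i) (leq_pmull _ (isT : (0 < 2)%N))) ]].

Lemma low_tuple_inj : injective low_tuple.
Proof.
move=> f f' /ffunP E; apply/ffunP => i.
have := congr1 val (E i); rewrite !ffunE /= => /(mulfI e_neq0) /u_inj.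
rewrite !inE => /(_ _ _)/block_index_inj2[] //.
  by have := block_index_lt f i; lia.
by have := block_index_lt f' i; lia.
Qed.

Lemma sum_low_tuple f : \sum_(i < k) val (low_tuple f i) = e * low_sum f.
Proof. by rewrite big_distrr /=; apply: eq_bigr => i _; rewrite ffunE. Qed.

Lemma blocks_energy :
  (q ^ (2 * k + 1) <= #|` subset_sums D| * additive_energy k D)%N.
Proof.
have [->|q_gt0] := posnP q; first by rewrite addn1 exp0n.
pose g (a : T * 'I_q) : subset_sums D :=
  [` low_high_in_subset_sums a.1 a.2 ].
have := card_sqr_le_collisions g.
rewrite card_prod card_ffun !card_ord -cardfE => CS.
have inj : (#|[set p | g p.1 == g p.2]| <= q * additive_energy k D)%N.
  (* Colliding pairs share [j], so storing it once with both tuples keeps [h] injective on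
     collisions. *)
  pose h (p : (T * 'I_q) * (T * 'I_q)) :=
    (p.1.2, (low_tuple p.1.1, low_tuple p.2.1)).
  have gE a b : g a = g b -> a.2 = b.2 /\ low_sum a.1 = low_sum b.1.
    by move=> /(congr1 val) /= /(mulfI e_neq0) /low_high_inj.
  rewrite -(card_in_imset (f := h)); last first.
    move=> [[f1 j1] [f2 j2]] [[f3 j3] [f4 j4]]; rewrite !inE.
    move=> /eqP/gE[/= <- _] /eqP/gE[/= <- _] [-> E1 E2].
    by rewrite (low_tuple_inj E1) (low_tuple_inj E2).
  rewrite -[q in (_ <= q * _)%N]card_ord -cardsT /additive_energy -cardsX.
  apply/subset_leq_card/subsetP => _ /imsetP[p + ->].
  rewrite !inE /= => /eqP/gE[_ E].
  by rewrite !sum_low_tuple E.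
rewrite -(leq_pmul2l q_gt0) mulnCA.
apply: leq_trans (leq_trans CS (leq_mul (leqnn _) inj)).
by rewrite -expnSr -expnM -expnS addn1 (mulnC 2) mulSn.
Qed.

End Blocks.

(** * From a finite set to a sorted positive sequence *)

Lemma signed_half (R : realType) (D : {fset R}) :
  exists2 e : R, e * e = 1 &
    (#|` D| <= 2 * count (fun x => 0 < e * x)%R D + 1)%N.
Proof.
pose c (e : R) := count (fun x => 0 < e * x)%R D.
have cnt : (#|` D| <= c 1%R + c (-1)%R + 1)%N.
  (* Zero is counted under neither sign, whence the extra 1. *)
  have c0 : (count_mem 0%R D <= 1)%N.
    by rewrite count_uniq_mem ?fset_uniq // leq_b1.
  apply: leq_trans (leq_add (leqnn _) c0).
  rewrite -(count_predT D) /c; elim: (enum_fset D) => //= x r IH.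
  by rewrite mul1r mulN1r oppr_gt0; case: (ltgtP x 0) => _ /=; lia.
have [le|lt] := leqP (c (-1)) (c 1).
- by exists 1; rewrite ?mulr1 // -/(c 1); lia.
- by exists (-1); rewrite ?mulrNN ?mulr1 // -/(c (-1)); lia.
Qed.

Lemma energy_bound (R : realType) (k q : nat) (D : {fset R}) :
  (0 < k)%N -> (4 * (k * q) < #|` D|)%N ->
  (q ^ (2 * k + 1) <= #|` subset_sums D| * additive_energy k D)%N.
Proof.
move=> k_gt0 hq; have [e ee half] := signed_half D.
have e_neq0 : e != 0.
  by apply/eqP => e0; move/eqP: ee; rewrite e0 mul0r eq_sym oner_eq0.
pose s := sort <=%R [seq e * x | x <- D & 0 < e * x].
have szs : (2 * (k * q) <= size s)%N.
  by rewrite size_sort size_map size_filter; lia.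
have s_in n : (n < 2 * (k * q))%N -> s`_n \in [seq e * x | x <- D & 0 < e * x].
  by move=> hn; rewrite -(mem_sort <=%R) mem_nth // (leq_trans hn szs).
(* The default 0 of [nth] is never read below [2 * (k * q)], by [szs]. *)
apply: (@blocks_energy R k q e D (nth 0 s)) => //.
- by move=> n /s_in/mapP[x + ->]; rewrite mem_filter => /andP[].
- move=> m n mn hn; have hs := leq_trans hn szs.
  rewrite lt_sorted_ltn_nth ?inE ?hs ?(ltn_trans mn hs) //.
  rewrite sort_lt_sorted map_inj_uniq; last exact: mulfI.
  by rewrite filter_uniq ?fset_uniq.
- move=> n /s_in/mapP[x + ->]; rewrite mem_filter => /andP[_ xD].
  by rewrite mulrA ee mul1r.
Qed.

(** * Choice of the block length and of the constant *)

Lemma additive_energy_gt0 (R : realType) (k : nat) (D : {fset R}) :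
  D != fset0 -> (0 < additive_energy k D)%N.
Proof.
move=> /fset0Pn[x xD]; apply/card_gt0P.
by exists ([ffun=> [` xD]], [ffun=> [` xD]]); rewrite inE.
Qed.

Lemma subset_sums_gt0 (R : realType) (D : {fset R}) :
  (0 < #|` subset_sums D|)%N.
Proof.
rewrite cardfs_gt0; apply/fset0Pn; exists (\sum_(x <- [::]) x).
exact: sum_in_subset_sums.
Qed.

(** The largest [q] with [4kq < m] satisfies [m <= 4k(q + 1)], which is at most [8kq] when [q > 0].
    When [q = 0], [m <= 8k] and the product on the right is at least 1. *)
Lemma energy_bound_card (R : realType) (k : nat) (D : {fset R}) :
  (0 < k)%N -> D != fset0 ->
  (#|` D| ^ (2 * k + 1) <=
     (8 * k) ^ (2 * k + 1) * (#|` subset_sums D| * additive_energy k D))%N.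
Proof.
move=> k_gt0 D0.
have prod_gt0 : (0 < #|` subset_sums D| * additive_energy k D)%N.
  by rewrite muln_gt0 subset_sums_gt0 additive_energy_gt0.
have m_gt0 : (0 < #|` D|)%N by rewrite cardfs_gt0.
set m := #|` D| in m_gt0 *; pose q := (m.-1 %/ (4 * k))%N.
have q_lo : (4 * (k * q) < m)%N.
  by have := leq_trunc_div m.-1 (4 * k); rewrite -/q; nia.
have q_hi : (m <= 4 * k * q.+1)%N.
  have k4 : (0 < 4 * k)%N by lia.
  by have := ltn_ceil m.-1 k4; rewrite -/q; nia.
have [q0|q_gt0] := posnP q.
  have le : (m <= 8 * k)%N by move: q_hi; rewrite q0; lia.
  by rewrite -[X in (X <= _)%N]muln1 leq_mul // leq_exp2r // addn1.
apply: leq_trans (leq_mul (leqnn _) (energy_bound k_gt0 q_lo)).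
by rewrite -expnMn leq_exp2r ?addn1 //; nia.
Qed.

Theorem theorem2p1 (R : realType) (k : nat) (hk : (1 <= k)%N) :
  exists2 c : R, 0 < c &
    forall D : {fset R}, D != fset0 ->
      c * (#|` D|%:R ^+ (2 * k + 1) / (additive_energy k D)%:R)
        <= #|` subset_sums D|%:R.
Proof.
have c_gt0 : 0 < (8 * k)%:R ^+ (2 * k + 1) :> R.
  by rewrite exprn_gt0 // ltr0n; lia.
exists ((8 * k)%:R ^+ (2 * k + 1))^-1; first by rewrite invr_gt0.
move=> D D0; have E_gt0 := additive_energy_gt0 k D0.
rewrite ler_pdivrMl // ler_pdivrMr ?ltr0n // -mulrA -!natrX -!natrM ler_nat.
exact: energy_bound_card.
Qed.
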